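(* Let $N\ge 7$ be an integer, $h>0$, and let $T_{\epsilon,\sigma}$ be the $N\times N$ matrix defined in the context. If $\epsilon=1$ and $2/9\le\sigma\le 4/7$, then $T_{\epsilon,\sigma}$ is irreducible, diagonally dominant, nonsingular, and an $M$-matrix.
   Context: The matrix $T_{\epsilon,\sigma}$ is the stiffness matrix of the cell centered Galerkin (CCG) discretization, with barycentric trace reconstruction, of $-u''=f$ on an interval with homogeneous Dirichlet conditions, on a uniform mesh of $N$ cells of size $h$. Explicitly, with real parameters $\epsilon$ and $\sigma$, put $$a=\tfrac{5\sigma}{4}-\tfrac{\epsilon}{4}+\tfrac34,\quad b=\tfrac{\epsilon}{16}-\tfrac{15\sigma}{16}-\tfrac1{16},\quad c=\tfrac{\epsilon}{8}+\tfrac{3\sigma}{8}-\tfrac38,\quad d=\tfrac1{16}-\tfrac{\sigma}{16}-\tfrac{\epsilon}{16},$$ $$a_1=\tfrac{5\sigma}{4}-\tfrac{3\epsilon}{16}+\tfrac{11}{16},\quad a_0=\tfrac{13\sigma}{8}-\tfrac{5\epsilon}{16}+\tfrac{13}{16},\quad b_0=\tfrac5{16}-\tfrac{9\sigma}{8}-\tfrac{\epsilon}{16},\quad c_0=\tfrac{3\epsilon}{16}+\tfrac{7\sigma}{16}-\tfrac7{16}.$$ Then $T_{\epsilon,\sigma}=\frac1h M$, where $M$ is the $N\times N$ matrix with entries (indices $1\le i,j\le N$): - $M_{ii}=a_0$ if $i\in\{1,N\}$, $M_{ii}=a_1$ if $i\in\{2,N-1\}$, and $M_{ii}=a$ otherwise;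 - if $|i-j|=1$: $M_{ij}=b_0$ when $\{i,j\}=\{1,2\}$ or $\{i,j\}=\{N-1,N\}$, and $M_{ij}=b$ otherwise; - if $|i-j|=2$: $M_{ij}=c_0$ when $\{i,j\}=\{1,3\}$ or $\{i,j\}=\{N-2,N\}$, and $M_{ij}=c$ otherwise; - if $|i-j|=3$: $M_{ij}=d$; - if $|i-j|\ge4$: $M_{ij}=0$. A matrix $T$ is irreducible if there is no permutation matrix $P$ such that $PTP^T$ is block upper triangular (with at least two square diagonal blocks). Diagonally dominant means (weak) row diagonal dominance: $|T_{ii}|\ge\sum_{j\ne i}|T_{ij}|$ for every $i$. A $Z$-matrix is a real square matrix with nonpositive off-diagonal entries; a (nonsingular) $M$-matrix is a $Z$-matrix that is nonsingular with entrywise nonnegative inverse. *)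

(* Defs.v *)
From mathcomp Require Import all_boot all_order all_fingroup all_algebra.
Set Implicit Arguments.
Unset Strict Implicit.
Unset Printing Implicit Defensive.
Import Order.TTheory GRing.Theory Num.Theory.
Local Open Scope ring_scope.

Section MatrixNotions.
Variables (R : realFieldType) (n : nat).
Implicit Type A : 'M[R]_n.

(* [sh] lists the (positive) sizes of the diagonal blocks, and                *)
(* [reshape_index sh i] is the number of the block containing the index i.    *)
Definition block_upper_triangular A : Prop :=
  exists sh : seq nat,
    [/\ (2 <= size sh)%N, all (fun k => 0 < k)%N sh, sumn sh = n
      & forall i j : 'I_n,
          (reshape_index sh j < reshape_index sh i)%N -> A i j = 0].

Definition irreducible_mx A : Prop :=
  ~ exists P : 'M[R]_n, is_perm_mx P /\ block_upper_triangular (P *m A *m P^T).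

Definition diagonally_dominant A : Prop :=
  forall i : 'I_n, \sum_(j < n | j != i) `|A i j| <= `|A i i|.

Definition Z_matrix A : Prop := forall i j : 'I_n, i != j -> A i j <= 0.

(* [invmx A] is the genuine inverse only because [A \in unitmx] is required.  *)
Definition M_matrix A : Prop :=
  [/\ Z_matrix A, A \in unitmx & forall i j : 'I_n, 0 <= invmx A i j].

End MatrixNotions.

Section CCG.
Variable R : realFieldType.
Implicit Types eps sigma : R.

Definition ccg_a eps sigma : R := 5 * sigma / 4 - eps / 4 + 3 / 4.
Definition ccg_b eps sigma : R := eps / 16 - 15 * sigma / 16 - 1 / 16.
Definition ccg_c eps sigma : R := eps / 8 + 3 * sigma / 8 - 3 / 8.
Definition ccg_d eps sigma : R := 1 / 16 - sigma / 16 - eps / 16.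
Definition ccg_a1 eps sigma : R := 5 * sigma / 4 - 3 * eps / 16 + 11 / 16.
Definition ccg_a0 eps sigma : R := 13 * sigma / 8 - 5 * eps / 16 + 13 / 16.
Definition ccg_b0 eps sigma : R := 5 / 16 - 9 * sigma / 8 - eps / 16.
Definition ccg_c0 eps sigma : R := 3 * eps / 16 + 7 * sigma / 16 - 7 / 16.

(* {i, j} = {k, l} as unordered pairs. *)
Definition same_pair (i j k l : nat) : bool :=
  ((i == k) && (j == l)) || ((i == l) && (j == k)).

(* Rows and columns are numbered from 1 to N here; `|i - j|%N is the distance *)
(* between the naturals i and j (not truncated).                              *)
Definition ccg_entry eps sigma (N i j : nat) : R :=
  match `|i - j|%N with
  | 0 => if (i == 1%N) || (i == N) then ccg_a0 eps sigma
         else if (i == 2%N) || (i == N - 1)%N then ccg_a1 eps sigma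
         else ccg_a eps sigma
  | 1 => if same_pair i j 1 2 || same_pair i j (N - 1) N then ccg_b0 eps sigma
         else ccg_b eps sigma
  | 2 => if same_pair i j 1 3 || same_pair i j (N - 2) N then ccg_c0 eps sigma
         else ccg_c eps sigma
  | 3 => ccg_d eps sigma
  | _ => 0
  end.

(* h is the mesh size; the shift by one converts the 0-based ordinals. *)
Definition ccg_mx (N : nat) (h eps sigma : R) : 'M[R]_N :=
  h^-1 *: \matrix_(i < N, j < N) ccg_entry eps sigma N i.+1 j.+1.

End CCG.

(* Main.v *)
Require Import Defs.
From mathcomp Require Import all_boot all_order all_fingroup all_algebra.
From mathcomp Require Import zify ring lra.
Set Implicit Arguments.
Unset Strict Implicit.
Unset Printing Implicit Defensive.
Import Order.TTheory GRing.Theory Num.Theory.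
Local Open Scope ring_scope.

(** The argument is the classical one for weakly diagonally dominant matrices
    that are irreducible and strictly dominant in at least one row.

    For eps = 1 and 2/9 <= sigma <= 4/7 every off-diagonal coefficient is
    nonpositive (b0 needs the lower bound, c0 the upper one), and the row sums
    of h T are 1/2 + 7 sigma / 8 in the two extreme rows, (1 - sigma) / 2 in
    the next two, sigma / 8 in the third row from either end, and 0 in all
    the others.  For a Z-matrix, nonnegative row sums amount to weak
    diagonal dominance with a nonnegative diagonal.

    Irreducibility is used through the directed graph of the nonzero entries:
    no nonempty proper set of indices is closed under following its arcs
    ([strongly_connected]).  In this graph the inner indices 2, ..., N - 1 are
    joined in a path by the coefficient b, and d = - sigma / 16 attaches 1 to
    4 and N to N - 3.  Using d here is uniform in sigma, whereas b0 vanishes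
    at sigma = 2/9 and c0 at sigma = 4/7.

    Nonsingularity and the sign of the inverse both come from a discrete
    minimum principle ([Z_matrix_monotone]): if A x >= 0 and x had a negative
    minimum, then the set where the minimum is attained would be closed, hence
    everything, so that x would be a negative constant; this contradicts the
    positive first row sum.  A matrix with this monotonicity property is
    injective, and its inverse is nonnegative because A maps the columns of
    the inverse to the standard basis vectors. *)

(** * Z-matrices with nonnegative row sums *)

Section ZMatrices.
Variables (R : realFieldType) (n : nat).
Implicit Types (A : 'M[R]_n) (x : 'cV[R]_n) (S : {set 'I_n}).

(** Strong connectedness of the digraph with an arc from i to j when
    A i j != 0, phrased by sets closed under arcs rather than by paths: both
    uses below produce such a closed set directly. *)
Definition strongly_connected A : Prop :=
  forall S, S != set0 ->
    (forall i j, i \in S -> A i j != 0 -> j \in S) -> S = setT.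

(** In a block upper triangular form no nonzero entry leads from a later block
    back to the first one, so the indices outside the first block form a
    closed set; it is nonempty and proper as there are at least two blocks. *)
Lemma strongly_connected_irreducible A :
  strongly_connected A -> irreducible_mx A.
Proof.
move=> conA [P [/is_perm_mxP[s ->] [[|k [|l r]] [//= _ pos sumE zero]]]].
move: pos => /and3P[k0 l0 _].
have n0 : (0 < n)%N by lia.
have kn : (k < n)%N by lia.
pose S := [set s i | i : 'I_n & (0 < reshape_index [:: k, l & r] i)%N].
(* k is the size of the first block, so position k starts the second one. *)
have blk0 : reshape_index [:: k, l & r] 0 = 0%N.
  by rewrite /reshape_index /= subn_eq0 k0.
have blkk : (0 < reshape_index [:: k, l & r] k)%N.
  by rewrite /reshape_index /= subn_eq0 ltnn.
have Sn0 : S != set0.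
  by apply/set0Pn; exists (s (Ordinal kn)); apply/imsetP; exists (Ordinal kn);
    rewrite ?inE.
have ST : S = setT.
  apply: conA Sn0 _ => ? j /imsetP[i]; rewrite inE => i_pos -> Aij.
  apply/imsetP; exists ((s^-1)%g j); last by rewrite permKV.
  rewrite inE lt0n; apply: contraNneq Aij => blkj.
  have := zero i ((s^-1)%g j); rewrite blkj => /(_ i_pos).
  (* The entries of P A P^T are A (s i) (s j). *)
  rewrite -row_permE tr_perm_mx -col_permE.
  by rewrite !mxE permKV => ->.
have: s (Ordinal n0) \in S by rewrite ST inE.
by case/imsetP=> i; rewrite inE => + /perm_inj iE; rewrite -iE blk0.
Qed.

Lemma Z_matrix_diagonally_dominant A :
  Z_matrix A -> (forall i, 0 <= \sum_j A i j) -> diagonally_dominant A.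
Proof.
move=> ZA sum_ge0 i; have := sum_ge0 i; rewrite (bigD1 i) //= => Ai.
have -> : \sum_(j < n | j != i) `|A i j| = - \sum_(j < n | j != i) A i j.
  rewrite -sumrN; apply: eq_bigr => j ji.
  by rewrite ler0_norm // ZA // eq_sym.
by apply: le_trans (ler_norm _); rewrite -subr_ge0 opprK.
Qed.

(** Minimum principle.  At an index i where the minimum mu of x is attained,
    (A x) i = sum_j A i j (x j - mu) + mu (sum_j A i j).  If mu < 0 both parts
    are nonpositive, so (A x) i >= 0 forces x j = mu whenever A i j != 0; by
    connectedness x is constant, which a positive row sum excludes. *)
Lemma Z_matrix_monotone A x :
    Z_matrix A -> (forall i, 0 <= \sum_j A i j) ->
    (exists i, 0 < \sum_j A i j) -> strongly_connected A ->
  (forall i, 0 <= (A *m x) i 0) -> forall i, 0 <= x i 0.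
Proof.
move=> ZA sum_ge0 [i0 sum_gt0] conA Ax i1; rewrite leNgt; apply/negP => xi1.
have [m _ m_min] := arg_minP (fun i => x i 0) (isT : predT i1).
have m_lt0 : x m 0 < 0 := le_lt_trans (m_min i1 isT) xi1.
have AxE i : (A *m x) i 0
    = \sum_j A i j * (x j 0 - x m 0) + x m 0 * \sum_j A i j.
  rewrite mxE mulr_sumr -big_split; apply: eq_bigr => j _ /=; ring.
have ST : [set i | x i 0 == x m 0] = setT.
  apply: conA => [|i j]; first by apply/set0Pn; exists m; rewrite inE.
  rewrite !inE => /eqP xi Aij.
  have term_ge0 k : true -> 0 <= - (A i k * (x k 0 - x m 0)).
    move=> _; rewrite oppr_ge0; have [<-|ik] := eqVneq i k.
      by rewrite xi subrr mulr0.
    by rewrite mulr_le0_ge0 ?ZA // subr_ge0 m_min.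
  have /eqP : \sum_k - (A i k * (x k 0 - x m 0)) = 0.
    apply/le_anti; rewrite sumr_ge0 // andbT sumrN oppr_le0.
    have : x m 0 * \sum_k A i k <= 0 by rewrite nmulr_rle0.
    have := Ax i; rewrite AxE; lra.
  rewrite psumr_eq0 // => /allP/(_ j (mem_index_enum j)).
  by rewrite /= oppr_eq0 mulf_eq0 (negPf Aij) subr_eq0.
have := Ax i0; rewrite AxE big1 => [|j _].
  by rewrite add0r nmulr_rge0 // leNgt sum_gt0.
have : j \in [set i | x i 0 == x m 0] by rewrite ST inE.
by rewrite inE => /eqP ->; rewrite subrr mulr0.
Qed.

(** If A x = 0 then monotonicity applies to both x and - x, whence x = 0. *)
Lemma monotone_unitmx A :
  (forall x, (forall i, 0 <= (A *m x) i 0) -> forall i, 0 <= x i 0) ->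
  A \in unitmx.
Proof.
move=> mono; rewrite -unitmx_tr -row_free_unit; apply: inj_row_free => v vA.
have Av : A *m v^T = 0 by rewrite -[A]trmxK -trmx_mul vA trmx0.
apply/rowP => j; rewrite mxE; apply/le_anti/andP; split.
  have := mono (- v^T) _ j; rewrite !mxE oppr_ge0; apply => i.
  by rewrite mulmxN Av oppr0 mxE.
by have := mono v^T _ j; rewrite !mxE; apply => i; rewrite Av mxE.
Qed.

Lemma monotone_M_matrix A :
    Z_matrix A ->
    (forall x, (forall i, 0 <= (A *m x) i 0) -> forall i, 0 <= x i 0) ->
  M_matrix A.
Proof.
(* A maps the columns of its inverse to the standard basis vectors. *)
move=> ZA mono; have uA := monotone_unitmx mono; split=> // i j.
have := mono (col j (invmx A)) _ i; rewrite [col _ _ _ _]mxE; apply => k.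
by rewrite colE mulmxA mulmxV // mul1mx mxE andbT ler0n.
Qed.

End ZMatrices.

(** * Signs and row sums of the stencil *)

Section Stencil.
Variables (R : realFieldType) (N : nat).
Implicit Type sigma : R.

Lemma ccg_entry_le0 sigma (i j : nat) : 2 / 9 <= sigma -> sigma <= 4 / 7 ->
  i != j -> ccg_entry 1 sigma N i j <= 0.
Proof.
move=> s_ge s_le ij; rewrite /ccg_entry.
case dE: (`|i - j|%N) => [|[|[|[|k]]]] //=.
- by exfalso; lia.
- by case: ifP => _; rewrite /ccg_b0 /ccg_b; lra.
- by case: ifP => _; rewrite /ccg_c0 /ccg_c; lra.
- by rewrite /ccg_d; lra.
Qed.

Lemma ccg_entry_dist3 sigma (i j : nat) : 0 < sigma ->
  (`|i - j|%N = 3)%N -> ccg_entry 1 sigma N i j != 0.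
Proof.
by move=> s_gt0; rewrite /ccg_entry => ->; apply/eqP; rewrite /ccg_d; lra.
Qed.

Lemma ccg_entry_dist1 sigma (i j : nat) : 0 < sigma ->
    (1 < i < N)%N -> (1 < j < N)%N -> (`|i - j|%N = 1)%N ->
  ccg_entry 1 sigma N i j != 0.
Proof.
move=> s_gt0 iN jN; rewrite /ccg_entry => ->.
rewrite ifF; last by rewrite /same_pair; lia.
by apply/eqP; rewrite /ccg_b; lra.
Qed.

Lemma ccg_entry_far eps sigma (i j : nat) : (3 < `|i - j|%N)%N ->
  ccg_entry eps sigma N i j = 0.
Proof. by rewrite /ccg_entry; case: (`|i - j|%N) => [|[|[|[|k]]]]. Qed.

(** The mesh is symmetric about its midpoint; this halves the rows whose sum
    has to be computed. *)
Lemma ccg_entry_rev eps sigma (i j : nat) : (0 < i <= N)%N -> (0 < j <= N)%N ->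
  ccg_entry eps sigma N (N.+1 - i) (N.+1 - j) = ccg_entry eps sigma N i j.
Proof.
move=> iN jN; rewrite /ccg_entry /same_pair.
have -> : `|(N.+1 - i)%N - (N.+1 - j)%N|%N = `|i - j|%N by lia.
case dE: (`|i - j|%N) => [|[|[|[|k]]]] //=.
- congr (if _ then _ else _); [lia|congr (if _ then _ else _); lia].
- congr (if _ then _ else _); lia.
- congr (if _ then _ else _); lia.
Qed.

(** The matrix is banded: a row sum, whose length depends on N, reduces to a sum
    over a fixed number of consecutive columns. *)
Lemma sum_window (F : nat -> R) p w : (p + w <= N)%N ->
    (forall j, (j < p)%N || (p + w <= j)%N -> F j = 0) ->
  \sum_(j < N) F j = \sum_(i < w) F (p + i)%N.
Proof.
move=> pwN F0; rewrite -(big_mkord xpredT F).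
rewrite (@big_cat_nat _ _ _ p) ?(leq_trans (leq_addr w p)) //=.
rewrite (@big_cat_nat _ _ _ (p + w)%N p) ?leq_addr //=.
have zero m n : (n <= p)%N || (p + w <= m)%N -> \sum_(m <= j < n) F j = 0.
  by move=> out; rewrite big_nat big1 // => j jmn; apply: F0; lia.
rewrite (zero 0 p) ?(zero _ N) ?leqnn ?orbT // add0r addr0.
rewrite -[p in \sum_(p <= _ < _) _]add0n big_addn addKn big_mkord.
by apply: eq_bigr => i _; rewrite addnC.
Qed.

Lemma ccg_entry_interior eps sigma (i j : nat) : (3 < i)%N -> (i + 3 <= N)%N ->
  ccg_entry eps sigma N i j =
  [:: ccg_a eps sigma; ccg_b eps sigma; ccg_c eps sigma; ccg_d eps sigma]`_
    (`|i - j|%N).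
Proof.
move=> i_gt3 iN; rewrite /ccg_entry /same_pair.
case dE: (`|i - j|%N) => [|[|[|[|k]]]] //=; last by rewrite nth_nil.
- by rewrite !ifF //; lia.
- by rewrite ifF //; lia.
- by rewrite ifF //; lia.
Qed.

(** The stencil discretizes - u'', so it annihilates constants away from the
    boundary: a + 2 b + 2 c + 2 d = 0. *)
Lemma row_sum_interior sigma i : (3 < i)%N -> (i + 3 <= N)%N ->
  \sum_(j < N) ccg_entry 1 sigma N i j.+1 = 0.
Proof.
move=> i_gt3 iN.
rewrite (@sum_window (fun j => ccg_entry 1 sigma N i j.+1) (i - 4) 7).
- under eq_bigr => k _.
    rewrite ccg_entry_interior //.
    have -> : `|i - (i - 4 + k).+1|%N = `|3 - k|%N by lia.
    over.
  rewrite !big_ord_recl big_ord0 /= /ccg_a /ccg_b /ccg_c /ccg_d; lra.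
- by lia.
- by move=> j jN; apply: ccg_entry_far; lia.
Qed.

Lemma row_sum_rev eps sigma i : (0 < i <= N)%N ->
  \sum_(j < N) ccg_entry eps sigma N (N.+1 - i) j.+1 =
  \sum_(j < N) ccg_entry eps sigma N i j.+1.
Proof.
move=> iN; rewrite (reindex_inj rev_ord_inj) /=; apply: eq_bigr => j _.
by rewrite -subSn // ccg_entry_rev //= ltn_ord.
Qed.

Lemma row_sum_first sigma : (7 <= N)%N -> 0 <= sigma ->
  0 < \sum_(j < N) ccg_entry 1 sigma N 1 j.+1.
Proof.
move=> hN s_ge0.
rewrite (@sum_window (fun j => ccg_entry 1 sigma N 1 j.+1) 0 4).
- rewrite !big_ord_recl big_ord0 /= /ccg_entry /=.
  by rewrite /ccg_a0 /ccg_b0 /ccg_c0 /ccg_d; lra.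
- by lia.
- by move=> j jN; apply: ccg_entry_far; lia.
Qed.

Lemma row_sum_second sigma : (7 <= N)%N -> sigma <= 1 ->
  0 <= \sum_(j < N) ccg_entry 1 sigma N 2 j.+1.
Proof.
move=> hN s_le1.
rewrite (@sum_window (fun j => ccg_entry 1 sigma N 2 j.+1) 0 5).
- case: N hN => [|[|[|[|[|[|[|n]]]]]]] // _.
  rewrite !big_ord_recl big_ord0 /= /ccg_entry /same_pair /=.
  by rewrite /ccg_a1 /ccg_b0 /ccg_b /ccg_c /ccg_d; lra.
- by lia.
- by move=> j jN; apply: ccg_entry_far; lia.
Qed.

Lemma row_sum_third sigma : (7 <= N)%N -> 0 <= sigma ->
  0 <= \sum_(j < N) ccg_entry 1 sigma N 3 j.+1.
Proof.
move=> hN s_ge0.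
rewrite (@sum_window (fun j => ccg_entry 1 sigma N 3 j.+1) 0 6).
- case: N hN => [|[|[|[|[|[|[|n]]]]]]] // _.
  rewrite !big_ord_recl big_ord0 /= /ccg_entry /same_pair /=.
  by rewrite /ccg_a /ccg_b /ccg_c0 /ccg_c /ccg_d; lra.
- by lia.
- by move=> j jN; apply: ccg_entry_far; lia.
Qed.

Lemma row_sum_ge0 sigma i : (7 <= N)%N -> 0 <= sigma <= 1 -> (0 < i <= N)%N ->
  0 <= \sum_(j < N) ccg_entry 1 sigma N i j.+1.
Proof.
move=> hN /andP[s_ge0 s_le1].
(* By symmetry only the upper half of the rows matters; there i > 3 implies
   i + 3 <= N because N >= 7. *)
wlog i_le : i / (2 * i <= N.+1)%N => [half iN | iN].
  have [/half->//|i_gt] := leqP (2 * i) N.+1.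
  by rewrite -row_sum_rev //; apply: half; lia.
case: i iN i_le => [|[|[|[|i]]]] // iN i_le.
- by rewrite ltW ?row_sum_first.
- by rewrite row_sum_second.
- by rewrite row_sum_third.
- by rewrite row_sum_interior //; lia.
Qed.

End Stencil.

(** * Irreducibility of the stencil *)

Section Connectivity.
Variables (R : realFieldType) (N : nat) (h sigma : R).
Hypotheses (hN : (7 <= N)%N) (h_gt0 : 0 < h) (s_gt0 : 0 < sigma).

(** A closed nonempty set reaches the inner indices 2, ..., N - 1 (from 1 or N
    by a jump of 3), then all of them through the coefficient b, and finally
    1 and N by jumps of 3 from 4 and N - 3. *)
Lemma ccg_mx_strongly_connected : strongly_connected (ccg_mx N h 1 sigma).
Proof.
move=> S /set0Pn[i0 i0S] clS.
(* Membership in S by 1-based natural indices, as in the stencil. *)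
pose inS k := [exists i : 'I_N, (i.+1 == k) && (i \in S)].
have inSP (i : 'I_N) : inS i.+1 = (i \in S).
  apply/existsP/idP => [[j /andP[/eqP[ji]]]|iS].
    by rewrite (val_inj ji).
  by exists i; rewrite eqxx.
have step k l :
    inS k -> (0 < l <= N)%N -> ccg_entry 1 sigma N k l != 0 -> inS l.
  move=> /existsP[i /andP[/eqP <- iS]] /andP[l_gt0 l_le] nz.
  have lN : (l.-1 < N)%N by lia.
  have lE : l = (Ordinal lN).+1 by rewrite /= prednK.
  rewrite lE inSP; apply: clS iS _.
  by rewrite !mxE -lE mulf_neq0 // invr_eq0 gt_eqF.
have step3 k l : inS k -> (0 < l <= N)%N -> (`|k - l|%N = 3)%N -> inS l.
  by move=> kS lN kl; apply: step kS lN _; apply: ccg_entry_dist3.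
have up k d : inS k -> (1 < k)%N -> (k + d < N)%N -> inS (k + d)%N.
  move=> kS k_gt1; elim: d => [|d IHd] kdN; first by rewrite addn0.
  apply: (step (k + d)%N); [by apply: IHd; lia|lia|].
  by apply: ccg_entry_dist1 => //; lia.
have down k d : inS (k + d)%N -> (1 < k)%N -> (k + d < N)%N -> inS k.
  move=> + k_gt1; elim: d => [|d IHd]; first by rewrite addn0.
  move=> kdS kdN; apply: IHd; last by lia.
  by apply: step kdS _ _; [lia|apply: ccg_entry_dist1 => //; lia].
have [k kS kN] : exists2 k, inS k & (1 < k < N)%N.
  have i0N := ltn_ord i0; have := i0S; rewrite -inSP => i0S'.
  have [i0_first|i0_gt1] := eqVneq i0.+1 1%N.
    by exists 4%N; [apply: step3 i0S' _ _; lia | lia].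
  have [i0_last|i0_ltN] := eqVneq i0.+1 N.
    by exists (N - 3)%N; [apply: step3 i0S' _ _; lia | lia].
  by exists i0.+1 => //; lia.
have inner l : (1 < l < N)%N -> inS l.
  move=> lN; have [kl|lk] := leqP k l.
    by rewrite -(subnKC kl); apply: up => //; lia.
  by apply: (down l (k - l)%N); rewrite ?subnKC ?(ltnW lk) //; lia.
apply/setP => i; rewrite inE -inSP; have iN := ltn_ord i.
have [i_first|i_gt1] := eqVneq i.+1 1%N.
  by apply: (step3 4%N); [apply: inner|..]; lia.
have [i_last|i_ltN] := eqVneq i.+1 N.
  by apply: (step3 (N - 3)%N); [apply: inner|..]; lia.
by apply: inner; lia.
Qed.

End Connectivity.

Theorem theorem9p3 (R : realFieldType) (N : nat) (h eps sigma : R)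
    (hN : (7 <= N)%N) (hh : 0 < h) (heps : eps = 1)
    (hsigma1 : 2 / 9 <= sigma) (hsigma2 : sigma <= 4 / 7) :
  [/\ irreducible_mx (ccg_mx N h eps sigma),
      diagonally_dominant (ccg_mx N h eps sigma),
      ccg_mx N h eps sigma \in unitmx
    & M_matrix (ccg_mx N h eps sigma)].
Proof.
subst eps; set A := ccg_mx N h 1 sigma.
have hV : 0 < h^-1 by rewrite invr_gt0.
have s_gt0 : 0 < sigma by lra.
have sumE i : \sum_j A i j = h^-1 * \sum_(j < N) ccg_entry 1 sigma N i.+1 j.+1.
  by rewrite mulr_sumr; apply: eq_bigr => j _; rewrite !mxE.
have ZA : Z_matrix A.
  move=> i j ij; rewrite !mxE pmulr_rle0 //; exact: ccg_entry_le0.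
have sum_ge0 i : 0 <= \sum_j A i j.
  rewrite sumE pmulr_rge0 //.
  by apply: row_sum_ge0; [| lra | exact: ltn_ord].
have sum_gt0 : exists i, 0 < \sum_j A i j.
  have N_gt0 : (0 < N)%N by lia.
  exists (Ordinal N_gt0); rewrite sumE pmulr_rgt0 //.
  exact: row_sum_first (ltW s_gt0).
have conA : strongly_connected A by apply: ccg_mx_strongly_connected.
have MA : M_matrix A.
  apply: monotone_M_matrix => // x.
  exact: Z_matrix_monotone.
split=> //; last by case: MA.
  exact: strongly_connected_irreducible.
exact: Z_matrix_diagonally_dominant.
Qed.
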